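(* Let $G$ be an extraspecial $2$-group of order $2^{2n+1}$ with center $Z=\{1,z\}$, let $S\subseteq G\setminus\{1\}$ be an admissible connecting set (see context), and let $\ell$ and $e_y$ ($y\in(\mathbb{Z}/2\mathbb{Z})^{2n}$) be the integers attached to $S$ as in the context. Let $X=\mathrm{Cay}(G,S)$. Then $X$ admits perfect state transfer at some time $\tau>0$ if and only if one of the following holds: (i) $z\in S$ and $\nu_2(\ell-e_y)\ge \nu_2(\ell+1)$ for all $y\in(\mathbb{Z}/2\mathbb{Z})^{2n}$; or (ii) $z\notin S$ and $\nu_2(\ell-e_y)\ge \nu_2(\ell)$ for all $y\in(\mathbb{Z}/2\mathbb{Z})^{2n}$. Moreover, let $\tau$ be a time at which $X$ admits perfect state transfer. If (i) holds then $\tau$ is an odd multiple of $\pi/2^{\nu_2(2\ell+2)}$, and if (ii) holds then $\tau$ is an odd multiple of $\pi/2^{\nu_2(2\ell)}$.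
   Context: An extraspecial $2$-group is a finite $2$-group $G$ whose center $Z$ has order $2$ and such that $G/Z\cong(\mathbb{Z}/2\mathbb{Z})^m$ for some $m\ge1$; its order is $2^{2n+1}$ for some $n\ge 1$. Let $z$ be the unique central involution, fix an isomorphism $G/Z\cong(\mathbb{Z}/2\mathbb{Z})^{2n}$, and write $\bar g$ for the image of $g\in G$ in $(\mathbb{Z}/2\mathbb{Z})^{2n}$. Conjugacy classes of noncentral elements are the cosets $K(x)=\{x,xz\}$. Admissible connecting set: $S\subseteq G\setminus\{1\}$ is a union of conjugacy classes of $G$ (hence closed under inverses), $S$ generates $G$, and $S\ne G\setminus\{1\}$. Write $S\setminus\{z\}=K(x_1)\cup\cdots\cup K(x_\ell)$ with distinct size-$2$ conjugacy classes $K(x_i)$; this defines $\ell$. For $y\in(\mathbb{Z}/2\mathbb{Z})^{2n}$, $e_y$ is the number of $i\in\{1,\dots,\ell\}$ with $y\cdot\bar x_i=0$ in $\mathbb{Z}/2\mathbb{Z}$ (standard dot product). $\mathrm{Cay}(G,S)$ is the graph with vertex set $G$ in which $g,h$ are adjacent iff $gh^{-1}\in S$. For a graph with adjacency matrix $A$, $U_A(t)=\sum_{k\ge0}\frac{(it)^k}{k!}A^k$. The graph admits perfect state transfer at time $\tau>0$ if there are distinct vertices $u,v$ and $\lambda\in\mathbb{C}$ with $U_A(\tau)e_u=\lambda e_v$, where $e_u$ is the standard basis vector of $u$. $\nu_2$ is the $2$-adic valuation, with $\nu_2(0)=+\infty$. *)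

(* Defs.v *)
From HB Require Import structures.
From mathcomp Require Import all_boot all_order all_algebra all_fingroup.
From mathcomp Require Import all_solvable mxabelem complex.
From mathcomp Require Import reals constructive_ereal topology normedtype.
From mathcomp Require Import sequences trigo.

Set Implicit Arguments.
Unset Strict Implicit.
Unset Printing Implicit Defensive.

Import Order.TTheory GRing.Theory Num.Theory.
Import numFieldNormedType.Exports.

Section Group.
Local Open Scope group_scope.

Definition extraspecial_2group (gT : finGroupType) (G : {group gT}) : Prop :=
  [/\ 2.-group G, #|'Z(G)| = 2
    & exists2 m : nat, (0 < m)%N & G / 'Z(G) \isog [set: 'rV['F_2]_m]].

Lemma extraspecial_2groupP (gT : finGroupType) (G : {group gT}) :
  extraspecial_2group G <-> 2.-group G /\ extraspecial G.
Proof.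
split=> [[pG oZ [m m_gt0 isoG]]|[pG esG]].
  split=> //; have abG : 2.-abelem (G / 'Z(G)).
    by rewrite (isog_abelem isoG); apply: mx_Fp_abelem.
  have sPZ : 'Phi(G) \subset 'Z(G) by rewrite (Phi_min pG) ?normal_norm ?center_normal.
  have sDP : G^`(1) \subset 'Phi(G) by rewrite (Phi_joing pG) joing_subl.
  have prZ : prime #|'Z(G)| by rewrite oZ.
  have ntD : G^`(1) :!=: 1.
    apply/eqP=> /derG1P abelG; have := card_isog isoG.
    rewrite card_quotient ?normal_norm ?center_normal //.
    rewrite /= (center_idP abelG) indexgg cardsT card_mx card_Fp // mul1n => oGZ.
    by have := ltn_expl m (isT : 1 < 2); rewrite -oGZ ltnS leqn0 (gtn_eqF m_gt0).
  have eDZ : G^`(1) = 'Z(G).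
    case: (prime_subgroupVti [group of G^`(1)] prZ) => [sZD|tiZ].
      by apply/eqP; rewrite eqEsubset sZD (subset_trans sDP).
    by case/eqP: ntD; rewrite -tiZ; apply/esym/setIidPl/(subset_trans sDP).
  by split=> //; split=> //; apply/eqP; rewrite eqEsubset sPZ -eDZ sDP.
have oZ := card_center_extraspecial pG esG; split=> //.
have [[PZ DZ] _] := esG.
have abG : 2.-abelem (G / 'Z(G)) by rewrite -PZ (Phi_quotient_abelem pG).
exists (logn 2 #|G / 'Z(G)|).
  rewrite lt0n; apply: contraTneq (extraspecial_nonabelian esG) => l0.
  have /eqP := card_pgroup (abelem_pgroup abG).
  rewrite l0 expn0 -trivg_card1 -subG1 quotient_sub1 ?subsetI ?normal_norm ?center_normal //.
  by case/andP=> _ cGG; rewrite /abelian cGG.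
rewrite (isog_abelem_card _ abG) mx_Fp_abelem //=.
by rewrite cardsT card_mx card_Fp // mul1n; apply/eqP/esym/card_pgroup/abelem_pgroup.
Qed.

Definition admissible (gT : finGroupType) (S : {set gT}) : Prop :=
  [/\ 1 \notin S,
      exists2 Cl : {set {set gT}}, Cl \subset classes [set: gT] & S = cover Cl,
      <<S>> = [set: gT]
    & S != [set: gT] :\ 1].

(* The representatives x 0, ..., x (l - 1) define the number l attached to S;
   both l and the counts e_num below are independent of their choice. *)
Definition class_decomposition (gT : finGroupType) (S : {set gT}) (z : gT)
    (l : nat) (x : 'I_l -> gT) : Prop :=
  [/\ forall i, #|x i ^: [set: gT]| = 2,
      injective (fun i => x i ^: [set: gT])
    & S :\ z = \bigcup_(i < l) x i ^: [set: gT]].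

Definition cayley (gT : finGroupType) (S : {set gT}) : rel gT :=
  [rel g h | g * h^-1 \in S].

End Group.

Local Open Scope ring_scope.
Local Open Scope complex_scope.

Definition dot (k : nat) (y x : 'rV['F_2]_k) : 'F_2 := \sum_(j < k) y 0 j * x 0 j.

(* e_y, where xbar i is the image of x i in (Z/2)^k *)
Definition e_num (k l : nat) (xbar : 'I_l -> 'rV['F_2]_k) (y : 'rV['F_2]_k) : nat :=
  #|[set i | dot y (xbar i) == 0]|.

(* 2-adic valuation, with the convention nu2 0 = +oo *)
Definition nu2 (m : int) : \bar int :=
  if m == 0 then +oo%E else ((logn 2 `|m|%N)%:Z)%:E.

(* sum of (i t)^k / k! A^k in the matrix topology, i.e. entrywise; the series
   converges for every A, so limn never takes its default value *)
Definition transition_matrix (R : realType) (n : nat) (A : 'M[R[i]]_n) (t : R)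
    : 'M[R[i]]_n :=
  limn (series (fun k => (('i * t%:C) ^+ k / k`!%:R) *: A ^+ k)).

Section Graph.
Variables (R : realType) (V : finType).

(* vertices index rows and columns through enum_val / enum_rank *)
Definition adjacency_matrix (adj : rel V) : 'M[R[i]]_#|V| :=
  \matrix_(a, b) (adj (enum_val a) (enum_val b))%:R.

Definition basis_vector (u : V) : 'cV[R[i]]_#|V| := delta_mx (enum_rank u) 0.

Definition pst_at (adj : rel V) (tau : R) : Prop :=
  0 < tau /\
  exists u v : V, u != v /\ exists lam : R[i],
    transition_matrix (adjacency_matrix adj) tau *m basis_vector u
      = lam *: basis_vector v.

End Graph.

Definition odd_multiple (R : realType) (c tau : R) : Prop :=
  exists k : int, tau = (2 * k + 1)%:~R * c.

(* Main.v *)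
Require Import Defs.
From mathcomp Require Import all_boot all_order all_algebra all_fingroup.
From mathcomp Require Import all_solvable complex reals constructive_ereal trigo.
From mathcomp Require boolp classical_sets functions topology normedtype.
From mathcomp Require sequences.
From mathcomp Require Import ring lra zify.

(* The adjacency algebra acts through class functions, so the transition
   matrix is a combination of the central idempotents of [G]: one per linear
   character [y], with eigenvalue [b + 2l - 4(l - e_y)] where [b = 1] if
   [z \in S] and [b = 0] otherwise, and [(1 - z)/2] with eigenvalue [-b].
   Comparing coefficients, perfect state transfer can only send [u] to [zu],
   and it occurs at time [t] iff every [exp(it lambda_y)] equals
   [- exp(- itb)], i.e. iff [2t(l + b)] is an odd multiple [(2a + 1) pi] and
   every [2t(l - e_y)] is a multiple of [pi]. This gives the valuation
   condition at once. For the time, the odd part [m] of [l + b] divides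
   [(2a + 1)(l - e_y)] for all [y]; since a Fourier coefficient of
   [l - e_y] is a power of two up to sign, [m] divides [2a + 1]. *)

Set Implicit Arguments.
Unset Strict Implicit.
Unset Printing Implicit Defensive.

Import Order.TTheory GRing.Theory Num.Theory.
Local Open Scope ring_scope.

(** * The complex exponential on the real line *)

Section ComplexExponential.
Import boolp classical_sets functions topology normedtype sequences.
Import numFieldNormedType.Exports.
Local Open Scope classical_set_scope.
Variable R : realType.
Implicit Types x y t : R.
Local Open Scope complex_scope.

Lemma real_complex_continuous :
  continuous (real_complex R : R -> (R[i] : numFieldType)).
Proof.
move=> x; apply/cvgrPdist_lt => e e0.
have /complex_realP[r er] : e \is Num.real by rewrite gtr0_real.
rewrite er in e0 *; rewrite (ltcR 0 r) in e0.
near=> y.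
rewrite -rmorphB normc_def /= expr0n /= addr0 sqrtr_sqr ltcR.
near: y; exact: cvgr_dist_lt.
Unshelve. all: by end_near. Qed.

(** This is exp(ix), given by its real and imaginary parts so that its power series splits into
    those of [cos] and [sin]. *)
Definition cis x : R[i] := cos x +i* sin x.

(** The two components copy the shape of [cos_coeff] and [sin_coeff]; the truncated [k.-1] at
    [k = 0] is harmless because its factor [odd k] vanishes. *)
Lemma i_pow k : 'i ^+ k =
  ((~~ odd k)%:R * (-1) ^+ k./2) +i* ((odd k)%:R * (-1) ^+ k.-1./2) :> R[i].
Proof.
rewrite -{1}(odd_double_half k) exprD -mul2n exprM sqr_i.
have -> : (-1) ^+ k./2 = ((-1) ^+ k./2)%:C :> R[i] by rewrite rmorphXn rmorphN1.
case: (boolP (odd k)) => ok /=; simpc; rewrite ?(mul0r, mul1r) //.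
by congr (_ +i* (_ ^+ _)); lia.
Qed.

Lemma cvg_series_cis x :
  series (fun k => ('i * x%:C) ^+ k / k`!%:R : R[i]) @ \oo -->
    (cis x : (R[i] : numFieldType)).
Proof.
have -> : series (fun k => ('i * x%:C) ^+ k / k`!%:R : R[i]) =
  (fun n => (series (cos_coeff x) n)%:C + 'i * (series (sin_coeff x) n)%:C).
  apply/funext => n; rewrite /series /= !rmorph_sum mulr_sumr -big_split /=.
  apply: eq_bigr => k _.
  rewrite exprMn i_pow -rmorphXn.
  have -> : (k`!%:R : R[i])^-1 = (k`!%:R^-1)%:C by rewrite fmorphV rmorph_nat.
  by rewrite /cos_coeff /sin_coeff /=; simpc.
have -> : cis x = (cos x)%:C + 'i * (sin x)%:C by rewrite /cis; simpc.
have cvgC (u : R^nat) (a : R) : u @ \oo --> a ->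
    (fun n => (u n)%:C) @ \oo --> (a%:C : (R[i] : numFieldType)).
  by move=> ua; apply: cvg_comp ua _; exact: real_complex_continuous.
apply: (@cvgD _ ((R[i] : numFieldType)^o));
  last apply: (@cvgMr _ nat \oo _ (fun n => (series (sin_coeff x) n)%:C)).
  by apply: cvgC; have := @is_cvg_series_cos_coeff R x; rewrite cos.unlock.
by apply: cvgC; have := @is_cvg_series_sin_coeff R x; rewrite sin.unlock.
Qed.

Lemma cis_neq0 x : cis x != 0.
Proof.
apply/eqP => -[c0 s0]; have := cos2Dsin2 x; rewrite c0 s0 expr0n addr0 => /eqP.
by rewrite eq_sym oner_eq0.
Qed.

Lemma cisD x y : cis (x + y) = cis x * cis y.
Proof. by rewrite /cis cosD sinD; simpc; congr (_ +i* _); ring. Qed.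

Lemma cis_pi_mul (k : int) : cis (k%:~R * pi) = (-1) ^+ `|k|%N.
Proof.
have cisn n : cis (n%:R * pi) = (-1) ^+ n.
  elim: n => [|n IHn]; first by rewrite mul0r /cis cos0 sin0.
  rewrite -natr1 mulrDl cisD IHn mul1r exprSr; congr (_ * _).
  by rewrite /cis cospi sinpi; apply/eqP; rewrite eq_complex /= oppr0 !eqxx.
case: k => n; first exact: cisn.
(* For a negative multiple, multiply by the opposite phase: both sides become 1. *)
apply: (mulIf (cis_neq0 (n.+1%:R * pi))); rewrite -cisD NegzE.
rewrite mulrNz mulNr addNr abszN cisn -exprD addnn -mul2n exprM sqrrN !expr1n.
by rewrite /cis cos0 sin0.
Qed.

(** Subtracting the floor multiple of [pi] leaves a remainder in [0, pi) whose sine is still zero;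
    positivity of [sin] on (0, pi) forces it to be 0. *)
Lemma sin_eq0_pi x : sin x = 0 -> exists k : int, x = k%:~R * pi.
Proof.
move=> sx0; pose k := Num.floor (x / pi); exists k.
pose r := x - k%:~R * pi.
have pi0 := @pi_gt0 R.
have r_ge0 : 0 <= r by rewrite subr_ge0 -ler_pdivlMr // floor_le.
have r_ltpi : r < pi.
  rewrite ltrBlDr -[X in X + _]mul1r -mulrDl.
  by have := floorD1_gt (x / pi); rewrite ltr_pdivrMr // rmorphD /= addrC.
have sr0 : sin r = 0.
  have := cisD x ((- k)%:~R * pi); rewrite cis_pi_mul mulrNz mulNr -/r.
  have -> : (-1) ^+ `|- k|%N = ((-1) ^+ `|- k|%N)%:C :> R[i].
    by rewrite rmorphXn rmorphN1.
  by rewrite /cis sx0; simpc => -[].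
apply/eqP; rewrite -subr_eq0 -/r; apply: contra_eqT sr0 => r0.
by rewrite gt_eqF // sin_gt0_pi // r_ltpi lt_neqAle eq_sym r0 r_ge0.
Qed.

Lemma cis_eq1P x : reflect (exists k : int, x = (2 * k)%:~R * pi) (cis x == 1).
Proof.
apply: (iffP eqP) => [[] |[k ->]]; last first.
  by rewrite cis_pi_mul abszM exprM sqrrN !expr1n.
(* The half-angle formula cos x = 1 - 2 sin^2(x/2) turns cos x = 1 into a zero of [sin]. *)
move=> cx _; have : sin (x / 2) = 0.
  have := cos_mulr2n (x / 2); rewrite -[x / 2 *+ 2]mulr_natr divfK ?pnatr_eq0 //.
  rewrite cx cos2sin2.
  move=> H; apply/eqP; rewrite -sqrf_eq0; apply/eqP; lra.
move=> /sin_eq0_pi[k xk]; exists k.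
by rewrite rmorphM /= -mulrA -xk mulrC divfK ?pnatr_eq0.
Qed.

Lemma cis_eqP x y :
  reflect (exists k : int, x - y = (2 * k)%:~R * pi) (cis x == cis y).
Proof.
have -> : (cis x == cis y) = (cis (x - y) == 1); last exact: cis_eq1P.
rewrite -[RHS](inj_eq (mulIf (cis_neq0 y))) -cisD subrK.
by rewrite mul1r.
Qed.

Lemma cis_eqNP x y :
  reflect (exists k : int, x - y = (2 * k + 1)%:~R * pi) (cis x == - cis y).
Proof.
have cispi : cis pi = -1 by have := cis_pi_mul 1; rewrite mul1r.
have -> : (cis x == - cis y) = (cis x == cis (y + pi)) by rewrite cisD cispi mulrN1.
by apply: (iffP (cis_eqP _ _)) => -[k xk]; exists k; move: xk;
  rewrite rmorphD /= mulrDl mul1r => xk; lra.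
Qed.

End ComplexExponential.

(** * Entrywise limits of matrices *)

Section MatrixLimit.
Import boolp classical_sets functions topology normedtype sequences.
Import numFieldNormedType.Exports.
Local Open Scope classical_set_scope.
Variables (K : numFieldType) (m n : nat).

Lemma cvg_mx_entries (u : nat -> 'M[K]_(m, n)) (M : 'M[K]_(m, n)) :
  (forall i j, (fun k => u k i j) @ \oo --> M i j) -> u @ \oo --> M.
Proof.
move=> uM; apply/cvg_ballP => e e0; near=> k; split=> //.
near: k; apply: filter_forall => i; apply: filter_forall => j.
by apply: (cvg_ball (uM i j)).
Unshelve. all: by end_near. Qed.

Lemma lim_mx_entries (u : nat -> 'M[K]_(m, n)) (M : 'M[K]_(m, n)) :
  (forall i j, (fun k => u k i j) @ \oo --> M i j) -> limn u = M.
Proof.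
move=> uM; apply: cvg_lim (cvg_mx_entries uM).
exact: (@norm_hausdorff K 'M[K]_(m, n)).
Qed.

End MatrixLimit.

(** * Transition matrix from a spectral decomposition *)

Section SpectralTransition.
Import boolp classical_sets functions topology normedtype sequences.
Import numFieldNormedType.Exports.
Local Open Scope classical_set_scope.
Local Open Scope complex_scope.
Variables (R : realType) (N : nat) (J : finType).
Variables (A : 'M[R[i]]_N) (E : J -> 'M[R[i]]_N) (mu : J -> R).
Hypothesis sumE : \sum_j E j = 1%:M.
Hypothesis eigE : forall j, A *m E j = (mu j)%:C *: E j.

(** Apply [A] repeatedly to the resolution of the identity; each step multiplies the [j]-th term by
    its eigenvalue. *)
Lemma spectral_pow k : A ^+ k = \sum_j (mu j)%:C ^+ k *: E j.
Proof.
elim: k => [|k IHk].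
  by rewrite expr0 -[LHS]sumE; apply: eq_bigr => j _; rewrite expr0 scale1r.
rewrite exprS IHk -mulmxE mulmx_sumr; apply: eq_bigr => j _.
by rewrite -scalemxAr eigE scalerA -exprSr.
Qed.

Lemma spectral_transition t :
  transition_matrix A t = \sum_j cis (t * mu j) *: E j.
Proof.
apply: lim_mx_entries => a b; rewrite summxE.
have -> : (fun n => series (fun k => (('i%R * t%:C) ^+ k / k`!%:R) *: A ^+ k) n a b)
  = (fun n => \sum_j
      series (fun k => ('i * (t * mu j)%:C) ^+ k / k`!%:R : R[i]) n * E j a b).
  apply/funext => n; rewrite /series /= summxE.
  under [RHS]eq_bigr do rewrite mulr_suml.
  rewrite exchange_big /=; apply: eq_bigr => k _.
  rewrite spectral_pow scaler_sumr summxE; apply: eq_bigr => j _.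
  by rewrite !mxE -complexiE rmorphM /= !exprMn; ring.
apply: (@cvg_big (R[i] : numFieldType) _ +%R) => [|j _].
  exact: (@pseudometric_normed_Zmodule.add_continuous _ ((R[i] : numFieldType)^o)).
by rewrite mxE; apply: (@cvgMl _ nat \oo _ _ _ _ (@cvg_series_cis _ _)).
Qed.
End SpectralTransition.

(** * Fourier analysis on the elementary abelian quotient *)

Section SignCharacters.
Variable k : nat.
Implicit Types y x : 'rV['F_2]_k.

(** The characters of (Z/2)^k, with integer values so that they can serve as coefficients in
    divisibility arguments. *)
Definition sgnchar y x : int := (-1) ^+ (dot y x != 0).

Lemma dotC y x : dot y x = dot x y.
Proof. by apply: eq_bigr => j _; rewrite mulrC. Qed.

Lemma dot0l x : dot 0 x = 0.
Proof. by rewrite /dot big1 // => j _; rewrite mxE mul0r. Qed.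

Lemma dotDl y1 y2 x : dot (y1 + y2) x = dot y1 x + dot y2 x.
Proof. by rewrite -big_split; apply: eq_bigr => j _; rewrite mxE mulrDl. Qed.

Lemma sgncharC y x : sgnchar y x = sgnchar x y.
Proof. by rewrite /sgnchar dotC. Qed.

Lemma sgnchar0 y : sgnchar y 0 = 1.
Proof. by rewrite /sgnchar dotC dot0l eqxx. Qed.

Lemma sgncharDl y1 y2 x : sgnchar (y1 + y2) x = sgnchar y1 x * sgnchar y2 x.
Proof.
rewrite /sgnchar dotDl; move: (dot y1 x) (dot y2 x).
by do 2![case=> [[|[|//]] ?]].
Qed.

Lemma sgncharDr y x1 x2 : sgnchar y (x1 + x2) = sgnchar y x1 * sgnchar y x2.
Proof. by rewrite sgncharC sgncharDl ![sgnchar _ y]sgncharC. Qed.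

Lemma sum_sgnchar x : \sum_y sgnchar y x = (x == 0)%:R * 2 ^+ k.
Proof.
have [->|/rV0Pn[j xj]] := eqVneq x 0.
  under eq_bigr do rewrite sgnchar0.
  by rewrite sumr_const card_mx card_Fp // mul1n natrX mul1r.
(* Translating [y] by the [j]-th unit vector, where [x] has a nonzero coordinate, flips the sign of
   every term. *)
rewrite mul0r; set s := \sum_y _; suff : s = - s by lia.
rewrite {1}/s (reindex_inj (addrI (delta_mx 0 j))) /= -sumrN.
apply: eq_bigr => y _; rewrite sgncharDl /sgnchar /dot (bigD1 j) //= big1.
  by rewrite mxE !eqxx mul1r addr0 xj mulN1r.
by move=> i ij; rewrite mxE (negPf ij) mul0r.
Qed.

Lemma addvv_F2 y : y + y = 0.
Proof.
by apply/rowP => j; rewrite !mxE; case: (y 0 j) => [[|[|//]] ?]; apply: val_inj.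
Qed.

Lemma sgnchar_orthogonal y1 y2 :
  \sum_x sgnchar y1 x * sgnchar y2 x = (y1 == y2)%:R * 2 ^+ k.
Proof.
under eq_bigr do rewrite -sgncharDl sgncharC.
rewrite sum_sgnchar; congr ((nat_of_bool _)%:R * _).
by rewrite -[RHS](inj_eq (addIr y2)) addvv_F2.
Qed.

(** Fourier inversion: a transform concentrated at 0 comes from a constant function. Pairing the
    transform with the character of [y] isolates [c y] by orthogonality. *)
Lemma sgnchar_inversion (K : comPzRingType) (c : 'rV['F_2]_k -> K) (a : K) :
    (forall x, \sum_y c y * (sgnchar y x)%:~R = (x == 0)%:R * a) ->
  forall y, 2 ^+ k * c y = a.
Proof.
move=> ca y.
have : \sum_x (sgnchar y x)%:~R * (\sum_y' c y' * (sgnchar y' x)%:~R) = a.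
  rewrite (bigD1 0) //= ca sgnchar0 eqxx !mul1r big1 ?addr0 // => x /negPf x0.
  by rewrite ca x0 mul0r mulr0.
move=> <-; under eq_bigr do rewrite mulr_sumr.
rewrite exchange_big /=.
under eq_bigr => y' _.
  under eq_bigr do rewrite mulrCA -intrM.
  rewrite -mulr_sumr -rmorph_sum /= sgnchar_orthogonal.
  over.
rewrite (bigD1 y) //= eqxx mul1r big1 ?addr0 => [|y' /negPf y'y].
  by rewrite rmorphXn mulrC.
by rewrite eq_sym y'y mul0r rmorph0 mulr0.
Qed.

(** The [e_num x y] indices with zero dot product contribute 1 each, the others -1. *)
Lemma sum_sgnchar_e_num l (x : 'I_l -> 'rV['F_2]_k) y :
  \sum_i sgnchar y (x i) = (e_num x y)%:Z *+ 2 - l%:Z.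
Proof.
transitivity (\sum_(i < l) (((dot y (x i) == 0) : nat)%:Z *+ 2 - 1)).
  by apply: eq_bigr => i _; rewrite /sgnchar; case: eqP.
rewrite sumrB sumrMnl sumr_const card_ord natz; congr (_ *+ 2 - _).
rewrite /e_num -sum1dep_card -[RHS]natz natr_sum [RHS]big_mkcond /=.
by apply: eq_bigr => i _; case: eqP.
Qed.

End SignCharacters.

Lemma e_num0 k l (x : 'I_l -> 'rV['F_2]_k) : e_num x 0 = l.
Proof.
by rewrite /e_num -sum1dep_card (eq_bigl xpredT) ?sum1_card ?card_ord // => i;
  rewrite dot0l eqxx.
Qed.

Lemma e_num_le k l (x : 'I_l -> 'rV['F_2]_k) y : (e_num x y <= l)%N.
Proof. by rewrite -[l in (_ <= l)%N]card_ord max_card. Qed.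

(** * Convolution operators on the group *)

Section ConnectionMatrix.
Variables (K : nzRingType) (gT : finGroupType).
Implicit Types f : gT -> K.

(** The matrix of left convolution by [f]; Cayley adjacency matrices are the case of an indicator
    function. *)
Definition translation_mx f : 'M[K]_#|gT| :=
  \matrix_(a, b) f (enum_val a * (enum_val b)^-1)%g.

Lemma mul_translation_mx (S : {set gT}) f :
  translation_mx (fun w => (w \in S)%:R) *m translation_mx f =
    translation_mx (fun w => \sum_(s in S) f (s^-1 * w)%g).
Proof.
apply/matrixP => a b; rewrite !mxE [RHS]big_mkcond /=.
(* The intermediate vertex c of a two-step walk from [a] is reindexed by s = a c^-1, the connecting
   element. *)
pose h (s : gT) : 'I_#|gT| := enum_rank (s^-1 * enum_val a)%g.
have h_bij : bijective h.
  exists (fun c => enum_val a * (enum_val c)^-1)%g => [s|c].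
    by rewrite /h enum_rankK invMg mulKVg invgK.
  by rewrite /h invMg invgK mulgKV enum_valK.
rewrite (reindex h) /=; last exact: onW_bij.
apply: eq_bigr => s _; rewrite !mxE /h enum_rankK invMg invgK mulKVg mulgA.
by case: ifP => _; rewrite ?mul1r ?mul0r.
Qed.

Lemma translation_mx_scale (c : K) f :
  c *: translation_mx f = translation_mx (fun w => c * f w).
Proof. by apply/matrixP => a b; rewrite !mxE. Qed.

Lemma translation_mx_sum (J : finType) (f : J -> gT -> K) :
  \sum_j translation_mx (f j) = translation_mx (fun w => \sum_j f j w).
Proof.
apply/matrixP => a b; rewrite !summxE !mxE.
by apply: eq_bigr => j _; rewrite mxE.
Qed.

Lemma translation_mx1 : translation_mx (fun w => (w == 1%g)%:R) = 1%:M.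
Proof.
apply/matrixP => a b; rewrite !mxE -eq_mulgV1.
by rewrite (inj_eq enum_val_inj).
Qed.

End ConnectionMatrix.

Lemma adjacency_cayley (R : realType) (gT : finGroupType) (S : {set gT}) :
  adjacency_matrix R (cayley S) = translation_mx (fun w => (w \in S)%:R).
Proof. by []. Qed.

(** The column at [u] lists the values of [f], with [f w] in row [w * u]; so it is supported at [v]
    exactly when [f] is supported at [v * u^-1]. *)
Lemma translation_mx_col (K : nzRingType) (gT : finGroupType) (f : gT -> K)
    (u v : gT) (lam : K) :
  translation_mx f *m delta_mx (enum_rank u) (0 : 'I_1) =
    lam *: delta_mx (enum_rank v) 0
  <-> forall w, f w = lam * (w == v * u^-1)%g%:R.
Proof.
split=> [/matrixP fuv w|fw].
  have := fuv (enum_rank (w * u)%g) 0.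
  rewrite !mxE (bigD1 (enum_rank u)) //= big1 => [|c cu].
    rewrite !mxE !enum_rankK !eqxx mulgK mulr1 addr0 => ->.
    congr (_ * (nat_of_bool _)%:R).
    by rewrite andbT (inj_eq enum_rank_inj) -(can2_eq (mulgK u) (mulgKV u)).
  by rewrite !mxE (negPf cu) mulr0.
apply/matrixP => a b; rewrite ord1 !mxE (bigD1 (enum_rank u)) //= big1 => [|c cu].
  rewrite !mxE enum_rankK !eqxx mulr1 addr0 fw andbT; congr (_ * (nat_of_bool _)%:R).
  by rewrite (inj_eq (mulIg _)) -[a in RHS]enum_valK (inj_eq enum_rank_inj).
by rewrite !mxE (negPf cu) mulr0.
Qed.

Lemma sum_option (V : nmodType) (T : finType) (F : option T -> V) :
  \sum_j F j = F None + \sum_y F (Some y).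
Proof.
rewrite (bigD1 None) //= (reindex_omap Some id) => [|[]//].
by congr (_ + _); apply: eq_bigl => y; rewrite eqxx.
Qed.

(** * The central quotient and conjugacy classes *)

Section CayleySpectrum.
Local Open Scope group_scope.
Variables (gT : finGroupType) (k : nat) (z : gT).
Variable phi : {morphism [set: gT] / 'Z([set: gT]) >-> 'rV['F_2]_k}.
Hypothesis cardZ : #|'Z([set: gT])| = 2%N.
Hypothesis hz : 'Z([set: gT]) = [set 1; z].
Hypothesis hphi : isom ([set: gT] / 'Z([set: gT])) [set: 'rV['F_2]_k] phi.

Definition quotient_vec (g : gT) : 'rV['F_2]_k := phi (coset 'Z([set: gT]) g).
Local Notation vec := quotient_vec.

Lemma in_norm_center (g : gT) : g \in 'N('Z([set: gT])).
Proof. by rewrite (subsetP (normal_norm (center_normal _))) ?inE. Qed.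

Lemma coset_center_in (g : gT) :
  coset 'Z([set: gT]) g \in [set: gT] / 'Z([set: gT]).
Proof. by rewrite mem_quotient ?inE. Qed.

Lemma quotient_vecM g h : vec (g * h) = (vec g + vec h)%R.
Proof. by rewrite /vec morphM ?in_norm_center // morphM ?coset_center_in. Qed.

Lemma quotient_vec1 : vec 1 = 0%R.
Proof. by rewrite /vec !morph1. Qed.

Lemma quotient_vecV g : vec g^-1 = vec g.
Proof.
by apply: (addIr (vec g)); rewrite -quotient_vecM mulVg quotient_vec1 addvv_F2.
Qed.

Lemma quotient_vec_eq0 g : (vec g == 0%R) = (g \in [set 1; z]).
Proof.
rewrite -hz; have [injphi _] := isomP hphi.
have -> : (vec g == 0%R) = (vec g == phi 1) by rewrite morph1.
rewrite /vec (inj_in_eq (injmP injphi)) ?coset_center_in ?group1 //.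
by apply/eqP/idP => [/(coset_idr (in_norm_center g))|/coset_id].
Qed.

Lemma quotient_vec_surj v : exists g, vec g = v.
Proof.
have [_ im] := isomP hphi; have : v \in [set: 'rV['F_2]_k] by rewrite inE.
rewrite -im => /morphimP[a _ /morphimP[g _ _ ->] ->]; by exists g.
Qed.

Lemma central_neq1 : z != 1.
Proof. by move: cardZ; rewrite hz cards2 eq_sym; case: eqP. Qed.

Lemma quotient_vec_central : vec z = 0%R.
Proof. by apply/eqP; rewrite quotient_vec_eq0 !inE eqxx orbT. Qed.

Lemma mulg_central_neq g : (g == g * z) = false.
Proof.
by rewrite -{1}[g]mulg1 (inj_eq (mulgI g)) eq_sym (negPf central_neq1).
Qed.

Lemma central_sqr : z * z = 1.
Proof.
have zZ : z \in 'Z([set: gT]) by rewrite hz set22.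
have : z * z \in 'Z([set: gT]) by rewrite groupM.
rewrite hz.
rewrite !inE => /orP[/eqP //|]; rewrite -{3}[z]mulg1 (inj_eq (mulgI z)).
by rewrite (negPf central_neq1).
Qed.

(** The quotient by the center is abelian, so a conjugate of [x] differs from [x] by 1 or [z]; the
    class has two elements, hence both occur. *)
Lemma central_class x : #|x ^: [set: gT]| = 2%N -> x ^: [set: gT] = [set x; x * z].
Proof.
move=> cx; apply/eqP; rewrite eqEcard cx cards2 mulg_central_neq andbT.
apply/subsetP => _ /imsetP[g _ ->].
have : vec (x^-1 * x ^ g) == 0%R.
  rewrite conjgE !quotient_vecM !quotient_vecV.
  by rewrite addrA addvv_F2.
rewrite quotient_vec_eq0 !inE -eq_invg_mul invgK eq_sym => /orP[->//|/eqP xz].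
by rewrite -[x ^ g](mulKVg x) xz eqxx orbT.
Qed.

(** * Eigenvalues and central idempotents of the Cayley graph *)

Section Spectrum.
Variables (S : {set gT}) (l : nat) (x : 'I_l -> gT).
Hypothesis hx : class_decomposition S z x.
Local Open Scope ring_scope.

Lemma sum_connection (V : nmodType) (F : gT -> V) :
  \sum_(s in S) F s =
    F z *+ (z \in S) + \sum_i (F (x i) + F (x i * z)%g).
Proof.
have [cx ix eS] := hx.
have -> : \sum_i (F (x i) + F (x i * z)%g) = \sum_(s in S :\ z) F s.
  rewrite eS partition_disjoint_bigcup => [|i j ij].
    apply: eq_bigr => i _; rewrite central_class // big_setU1 ?big_set1 //=.
    by rewrite inE mulg_central_neq.
  apply/pred0P => g; apply: contra_neqF ij => /andP[gi gj]; apply: ix.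
  by rewrite -(class_eqP gi) -(class_eqP gj).
by case: (boolP (z \in S)) => zS; rewrite ?(big_setD1 z zS) // add0r;
  apply: eq_bigl => s; rewrite !inE; case: eqP => // ->; rewrite (negPf zS).
Qed.

Let e := e_num (fun i => vec (x i)).

(* [Some y] indexes the linear character attached to [y], [None] the unique
   irreducible character that is nontrivial on the center. *)
Definition cayley_eigenvalue (j : option 'rV['F_2]_k) : int :=
  if j is Some y then (z \in S)%:Z + 2 * (2 * (e y)%:Z - l%:Z)
  else - (z \in S)%:Z.

Variable K : numFieldType.

(** Coefficient functions of the central idempotents; [2 * 2 ^+ k] is the order of the group, and
    the [None] case is (1 - z)/2. *)
Definition cayley_idempotent (j : option 'rV['F_2]_k) (w : gT) : K :=
  if j is Some y then (sgnchar y (vec w))%:~R / (2 * 2 ^+ k)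
  else ((w == 1%g)%:R - (w == z)%:R) / 2.

Lemma sum_cayley_idempotent w :
  \sum_j cayley_idempotent j w = (w == 1%g)%:R.
Proof.
have k2 : 2 * 2 ^+ k != 0 :> K by rewrite mulf_neq0 ?expf_neq0 ?pnatr_eq0.
rewrite sum_option /= -mulr_suml -rmorph_sum sum_sgnchar quotient_vec_eq0 !inE.
have -> : ((w == 1%g) || (w == z))%:R =
    (w == 1%g)%:R + (w == z)%:R :> int.
  have [->|_] := eqVneq w 1%g; last by rewrite add0r.
  by rewrite /= [_ == z]eq_sym (negPf central_neq1).
rewrite rmorphM rmorphXn rmorphD /= !rmorph_nat.
have k0 : 2 ^+ k != 0 :> K by rewrite expf_neq0 ?pnatr_eq0.
field.
by rewrite k0.
Qed.

(** A linear character is multiplicative, so its sum over [S] factors out. The [None] function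
    changes sign under [z], so [x i] and [x i * z] cancel and only a possible term at [z]
    survives. *)
Lemma sum_connection_idempotent j w :
  \sum_(s in S) cayley_idempotent j (s^-1 * w)%g =
    (cayley_eigenvalue j)%:~R * cayley_idempotent j w.
Proof.
case: j => [y|] /=.
  have sE s : (sgnchar y (vec (s^-1 * w)%g))%:~R / (2 * 2 ^+ k) =
      (sgnchar y (vec s))%:~R * ((sgnchar y (vec w))%:~R / (2 * 2 ^+ k)) :> K.
    by rewrite quotient_vecM quotient_vecV sgncharDr rmorphM mulrA.
  under eq_bigr do rewrite sE.
  rewrite -mulr_suml sum_connection quotient_vec_central sgnchar0.
  under eq_bigr do rewrite quotient_vecM quotient_vec_central addr0.
  rewrite big_split /= -rmorph_sum -mulr2n sum_sgnchar_e_num -/e.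
  congr (_ * _); case: (z \in S);
    by rewrite /= !(rmorphD, rmorphM, rmorphMn, rmorphN) /=; ring.
have sE s : ((s^-1 * w == 1)%g%:R - (s^-1 * w == z)%g%:R) / 2 =
    ((w == s)%:R - (w == s * z)%g%:R) / 2 :> K.
  by rewrite -!(inj_eq (mulgI s) (s^-1 * w)%g) !mulKVg mulg1.
under eq_bigr do rewrite sE.
rewrite sum_connection central_sqr big1 => [|i _].
  by case: (z \in S); rewrite /= ?addr0 ?mulr1n ?rmorphN /= ?rmorph0; field.
by rewrite -mulgA central_sqr mulg1; field.
Qed.

Lemma cayley_idempotent_eigen j :
  translation_mx (fun w => (w \in S)%:R) *m translation_mx (cayley_idempotent j) =
    (cayley_eigenvalue j)%:~R *: translation_mx (cayley_idempotent j).
Proof.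
rewrite mul_translation_mx translation_mx_scale.
by apply/matrixP => a b; rewrite !mxE sum_connection_idempotent.
Qed.

Lemma sum_translation_idempotent :
  \sum_j translation_mx (cayley_idempotent j) = 1%:M :> 'M[K]_#|gT|.
Proof.
rewrite translation_mx_sum -translation_mx1.
by apply/matrixP => a b; rewrite !mxE sum_cayley_idempotent.
Qed.

(* The Fourier expansion of a scaled delta function at [w0 != 1]: evaluating
   at [1] and [z] forces [w0 = z], then inversion on [G / Z] gives the rest. *)
Lemma delta_idempotent_combination (c : option 'rV['F_2]_k -> K) : c None != 0 ->
  (exists2 w0, w0 != 1%g & exists lam, forall w,
     \sum_j c j * cayley_idempotent j w = lam * (w == w0)%:R) <->
  (forall y, c (Some y) = - c None).
Proof.
move=> d0; have z1 := negPf central_neq1.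
have n20 : 2 != 0 :> K by rewrite pnatr_eq0.
have k0 : 2 ^+ k != 0 :> K by rewrite expf_neq0.
have combE w : \sum_j c j * cayley_idempotent j w =
    c None * (((w == 1%g)%:R - (w == z)%:R) / 2) +
    (\sum_y c (Some y) * (sgnchar y (vec w))%:~R) / (2 * 2 ^+ k).
  rewrite sum_option mulr_suml; congr (_ + _).
  by apply: eq_bigr => y _; rewrite /= mulrA.
split=> [[w0 w01 [lam cw]] y|cN]; last first.
  exists z; first exact: central_neq1.
  exists (- c None) => w; rewrite combE.
  under eq_bigr do rewrite cN.
  rewrite -mulr_sumr -rmorph_sum sum_sgnchar quotient_vec_eq0 !inE.
  rewrite rmorphM rmorphXn /= !rmorph_nat.
  have [->|w1] := eqVneq w 1%g; last by case: (w == z) => /=; field; rewrite k0.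
  by rewrite /= eq_sym z1 /=; field; rewrite k0.
have w0z : w0 = z /\ lam = - c None.
  have c1 := cw 1%g; have cz := cw z.
  rewrite combE quotient_vec1 in c1; rewrite combE quotient_vec_central in cz.
  rewrite !eqxx z1 in cz.
  rewrite !eqxx [1%g == z]eq_sym z1 [1%g == w0]eq_sym (negPf w01) in c1.
  (* [1] and [z] have the same image in the quotient, so the linear characters contribute equally at
     both. The value at [1] is zero since [w0] is not [1]; subtracting it from the value at [z]
     leaves [- c None]. *)
  have cz' : lam * (z == w0)%:R = - c None.
    move/eqP: c1; rewrite mulr0 addrC addr_eq0 => /eqP c1.
    by rewrite -cz c1 /=; field.
  move: cz'; case: eqP => [->|_]; first by rewrite mulr1.
  by move/eqP; rewrite mulr0 eq_sym oppr_eq0 (negPf d0).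
case: w0z cw => -> -> cw.
apply: (mulfI k0); apply: (@sgnchar_inversion _ _ (fun y => c (Some y))) => v.
have [g <-] := quotient_vec_surj v.
have := cw g; rewrite combE quotient_vec_eq0 !inE => cg.
apply: (mulIf (_ : (2 * 2 ^+ k)^-1 != 0)); first by rewrite invr_neq0 ?mulf_neq0.
rewrite (canRL (addKr _) cg).
have [->|w1] := eqVneq g 1%g; last by case: (g == z) => /=; field; rewrite k0.
by rewrite /= eq_sym z1 /=; field; rewrite k0.
Qed.
End Spectrum.
End CayleySpectrum.

(** * Valuations and admissible times *)

Section Arithmetic.

Lemma nu2_le_dvdn (N D : nat) : (0 < N)%N ->
  (nu2 N%:Z <= nu2 D%:Z)%E = (2 ^ logn 2 N %| D)%N.
Proof.
move=> N0; rewrite /nu2 !eqz_nat eqn0Ngt N0 /=.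
have [->|D0] := posnP D; first by rewrite dvdn0 leey.
by rewrite lee_fin lez_nat pfactor_dvdn.
Qed.

Lemma nu2_sub_le_dvdn (N l e : nat) : (0 < N)%N -> (e <= l)%N ->
  (nu2 N%:Z <= nu2 (l%:Z - e%:Z))%E = (2 ^ logn 2 N %| l - e)%N.
Proof. by move=> N0 el; rewrite subzn // nu2_le_dvdn. Qed.

Variables (R : realType) (Y : Type) (D : Y -> nat) (N : nat).
Hypothesis N_gt0 : (0 < N)%N.

(** To be used with N = l + b and D y = l - e_y. The integer [a] is exposed because the possible
    times are read off from the divisors of 2a + 1. *)
Definition transfer_phase (t : R) (a : int) : Prop :=
  t * (2 * N)%:R = (2 * a + 1)%:~R * pi /\
  forall y, exists k : int, t * (2 * D y)%:R = k%:~R * pi.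

(** Eliminate t / pi between the two phase equations. *)
Lemma transfer_phase_dvd t a y : transfer_phase t a ->
  exists k : int, (2 * a + 1) * (D y)%:Z = N%:Z * k.
Proof.
move=> [tN tD]; have [k tk] := tD y; exists k; apply: (@intr_inj R).
have pi0 : pi != 0 :> R by rewrite gt_eqF // pi_gt0.
apply: (mulIf pi0); rewrite !rmorphM /= -!pmulrn.
rewrite [LHS]mulrAC -[_ * pi in LHS]tN -[RHS]mulrA -tk !natrM; ring.
Qed.

Lemma transfer_phase_dvdn t a y : transfer_phase t a -> (2 ^ logn 2 N %| D y)%N.
Proof.
move=> /(transfer_phase_dvd y)[k ak].
have : ((2 ^ logn 2 N)%N%:Z %| (2 * a + 1) * (D y)%:Z)%Z.
  by rewrite ak dvdz_mulr // dvdzE /= pfactor_dvdnn.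
rewrite mulrC Gauss_dvdzl ?dvdzE //.
rewrite coprimezE /= coprimeXl // coprime2n. lia.
Qed.

Lemma transfer_phase_exists : (forall y, (2 ^ logn 2 N %| D y)%N) ->
  exists a, transfer_phase (pi / 2 ^+ (logn 2 N).+1) a.
Proof.
move=> dvdD; have [//|m m_odd] := @pfactor_coprime 2 N _ N_gt0.
move: dvdD; set s := logn 2 N => dvdD Nm.
have p0 : 2 ^+ s != 0 :> R by rewrite expf_neq0 ?pnatr_eq0.
(* At this time the phase of [N] is m pi with [m] the odd part of [N], so 2a + 1 = m. *)
exists (m./2); split=> [|y].
  have -> : 2 * (m./2)%:Z + 1 = m%:Z by rewrite coprime2n in m_odd; lia.
  by rewrite Nm !natrM natrX exprS -pmulrn; field.
have /dvdnP[d ->] := dvdD y; exists d%:Z.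
by rewrite !natrM natrX exprS -pmulrn; field.
Qed.

End Arithmetic.

Lemma transfer_phase_odd_multiple (R : realType) (Y : finType) (D : Y -> nat)
    (N M : nat) (w : Y -> int) (t : R) (a : int) : (0 < N)%N ->
    \sum_y w y * (D y)%:Z = - 2 ^+ M ->
  transfer_phase D N t a -> odd_multiple (pi / 2 ^+ (logn 2 N).+1) t.
Proof.
move=> N0 wD ta; have [//|m m_odd Nm] := @pfactor_coprime 2 N _ N0.
have m_dvd : (m%:Z %| 2 * a + 1)%Z.
  have : (m%:Z %| (2 * a + 1) * 2 ^+ M)%Z.
    rewrite -[2 ^+ M]opprK -wD mulrN dvdzE abszN -dvdzE mulr_sumr.
    apply: rpred_sum => y _; have [k ak] := transfer_phase_dvd y ta.
    by rewrite mulrCA ak Nm PoszM mulrCA -mulrA dvdz_mulr.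
  by rewrite Gauss_dvdzl // coprimezE abszX coprimeXr // coprime_sym.
have [q aq] := dvdzP m_dvd.
(* The quotient [q] is odd because its product with [m] is the odd number 2a + 1. *)
have [k qk] : exists k : int, q = 2 * k + 1.
  exists (q %/ 2)%Z; have := divz_eq q 2; have := modz_ge0 q (isT : 2 != 0 :> int).
  have := ltz_pmod q (isT : 0 < 2 :> int).
  move: (q %/ 2)%Z (q %% 2)%Z => k r r2 r0 qE.
  have [r1|r00] : r = 1 \/ r = 0 by lia.
    by rewrite qE r1 mulrC.
  by move: aq; rewrite qE r00 addr0 mulrAC; set km := k * m => aq; lia.
exists k; rewrite -qk; have [tN _] := ta.
move: tN; rewrite aq; move: Nm; set s := logn 2 N => Nm; rewrite Nm.
have p0 : 2 ^+ s != 0 :> R by rewrite expf_neq0 ?pnatr_eq0.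
have m0 : m%:R != 0 :> R
  by rewrite pnatr_eq0; apply: contraTneq N0 => m0; rewrite Nm m0.
rewrite !natrM natrX rmorphM /= -pmulrn => tN.
apply: (mulIf (_ : 2 * (m%:R * 2 ^+ s) != 0));
  first by rewrite mulf_neq0 ?pnatr_eq0 // mulf_neq0.
by rewrite tN exprS; field.
Qed.

(** * State transfer on the Cayley graph *)

Section StateTransfer.
Variables (R : realType) (gT : finGroupType) (k : nat) (z : gT).
Variable phi : {morphism ([set: gT] / 'Z([set: gT]))%g >-> 'rV['F_2]_k}.
Hypothesis cardZ : #|'Z([set: gT])%g| = 2%N.
Hypothesis hz : ('Z([set: gT]) = [set 1; z])%g.
Hypothesis hphi : isom ([set: gT] / 'Z([set: gT]))%g [set: 'rV['F_2]_k] phi.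
Variables (S : {set gT}) (l : nat) (x : 'I_l -> gT).
Hypothesis hx : class_decomposition S z x.

Let vec := quotient_vec phi.
Let e := e_num (fun i => vec (x i)).
Let eig := cayley_eigenvalue z phi S x.

Lemma cayley_transition (t : R) :
  transition_matrix (adjacency_matrix R (cayley S)) t =
  translation_mx (fun w => \sum_j cis (t * (eig j)%:~R)
                             * cayley_idempotent z phi R[i]%C j w).
Proof.
rewrite adjacency_cayley.
rewrite (spectral_transition (sum_translation_idempotent cardZ hz hphi _)
  (mu := fun j => (eig j)%:~R)).
  by apply/matrixP => a b; rewrite summxE !mxE; apply: eq_bigr => j _; rewrite !mxE.
by move=> j; rewrite rmorph_int; apply: cayley_idempotent_eigen.
Qed.

Lemma pst_phase (t : R) :
  pst_at (cayley S) t <->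
  0 < t /\ exists a, transfer_phase (fun y => l - e y)%N (l + (z \in S)) t a.
Proof.
have phaseE :
    (forall y, cis (t * (eig (Some y))%:~R) = - cis (t * (eig None)%:~R)) <->
    exists a, transfer_phase (fun y => l - e y)%N (l + (z \in S)) t a.
  have eigB y : t * (eig (Some y))%:~R - t * (eig None)%:~R =
      t * (2 * (l + (z \in S)))%:R - 2 * (t * (2 * (l - e y))%:R).
    rewrite !natrM natrB ?e_num_le // natrD /eig /= -/vec -/e.
    by rewrite !(rmorphD, rmorphM, rmorphN, rmorphB) /= -!pmulrn; ring.
  have eigB0 : t * (eig (Some 0))%:~R - t * (eig None)%:~R =
      t * (2 * (l + (z \in S)))%:R.
    by rewrite eigB /e e_num0 subnn muln0 !mulr0 subr0.
  split=> [cE|[a [tN tD]] y].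
    (* Since e_0 = l, the trivial character alone gives the odd multiple for l + b. Subtracting it
       from the condition at [y] leaves an even multiple of pi for 4t(l - e_y), which is then
       halved. *)
    have /eqP/cis_eqNP[a] := cE 0; rewrite eigB0 => tN; exists a; split=> // y.
    have /eqP/cis_eqNP[b] := cE y; rewrite eigB tN => tD; exists (a - b).
    move: tD; rewrite !(rmorphD, rmorphM, rmorphB, rmorphN) /=; lra.
  apply/eqP/cis_eqNP; have [b tDy] := tD y; exists (a - b).
  rewrite eigB tN tDy !(rmorphD, rmorphM, rmorphB, rmorphN) /=; lra.
rewrite -phaseE.
rewrite -(delta_idempotent_combination cardZ hz hphi
  (c := fun j => cis (t * (eig j)%:~R)) (cis_neq0 _)).
rewrite /pst_at cayley_transition; split=> -[t0].
  move=> [u [v [uv [lam /translation_mx_col fw]]]]; split=> //.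
  exists (v * u^-1)%g; last by exists lam.
  by rewrite -eq_mulgV1 eq_sym.
move=> [w0 w01 [lam fw]]; split=> //; exists 1%g, w0; rewrite eq_sym; split=> //.
by exists lam; apply/translation_mx_col => w; rewrite invg1 mulg1.
Qed.

(** The fibres of [vec] are the cosets of the center, and a class of size two is such a coset. *)
Lemma class_vec_inj : injective (fun i => vec (x i)).
Proof.
have [cx ix _] := hx; move=> i j /= ij; apply: ix.
have : vec ((x i)^-1 * x j)%g == 0.
  by rewrite /vec quotient_vecM quotient_vecV -/vec ij addvv_F2.
rewrite (quotient_vec_eq0 hz hphi) -hz => xijZ; apply/class_eqP.
rewrite (central_class cardZ hz hphi (cx j)).
move: xijZ; rewrite hz !inE -eq_mulVg1 => /orP[/eqP->|/eqP xz];
  first by rewrite eqxx.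
by rewrite -[x j](mulKVg (x i)) xz -mulgA (central_sqr cardZ hz) mulg1 eqxx orbT.
Qed.

(** This is the Fourier coefficient of 2(l - e_y) = l - sum_j chi_y(x_j) at the image of [x i]. That
    image is nonzero, which kills the constant [l]; the images are distinct, so orthogonality keeps
    only j = i. *)
Lemma sum_sgnchar_deficit (i : 'I_l) :
  \sum_y sgnchar y (vec (x i)) * (l - e y)%N%:Z *+ 2 = - 2 ^+ k.
Proof.
have [cx _ _] := hx.
have vi0 : vec (x i) != 0.
  rewrite (quotient_vec_eq0 hz hphi) -hz /center setTI.
  apply/negP => /cent_classP xc.
  by have := cx i; rewrite xc cards1.
have dE y : (l - e y)%N%:Z *+ 2 = l%:Z - \sum_j sgnchar y (vec (x j)).
  by rewrite sum_sgnchar_e_num -subzn ?e_num_le // -/e; lia.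
under eq_bigr do rewrite -mulrnAr dE mulrBr mulr_sumr.
rewrite sumrB -mulr_suml sum_sgnchar (negPf vi0) !mul0r sub0r exchange_big /=.
congr (- _); have orth j : \sum_y sgnchar y (vec (x i)) * sgnchar y (vec (x j)) =
    (i == j)%:R * 2 ^+ k.
  rewrite -(inj_eq class_vec_inj) -sgnchar_orthogonal.
  by apply: eq_bigr => y _; rewrite sgncharC [sgnchar y _]sgncharC.
under eq_bigr do rewrite orth.
rewrite (bigD1 i) //= big1 ?addr0 => [|j ji]; first by rewrite eqxx mul1r.
by rewrite eq_sym (negPf ji) mul0r.
Qed.

(** Without noncentral classes [S] would lie in the center, and so would the group it generates. *)
Lemma class_count_gt0 : admissible S -> (2 < #|gT|)%N -> (0 < l)%N.
Proof.
move=> [_ _ genS _] cG; have [_ _ eS] := hx; rewrite lt0n; apply/eqP => l0.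
suff : (#|[set: gT]| <= 2)%N by rewrite cardsT leqNgt cG.
suff SZ : S \subset 'Z([set: gT])%g.
  by rewrite -genS -cardZ subset_leq_card // gen_subG.
rewrite hz; apply/subsetP => g gS; rewrite !inE.
have [->|gz] := eqVneq g z; first by rewrite orbT.
have : g \in S :\ z by rewrite !inE gz.
rewrite eS => /bigcupP[i _ _]; by have := leq_ltn_trans (leq0n i) (ltn_ord i); rewrite l0.
Qed.

Lemma pst_iff : (0 < l)%N ->
  (exists t : R, pst_at (cayley S) t) <->
  forall y, (nu2 (l + (z \in S))%N%:Z <= nu2 (l%:Z - (e y)%:Z))%E.
Proof.
move=> l0; have N0 : (0 < l + (z \in S))%N by rewrite addn_gt0 l0.
split=> [[t /pst_phase[_ [a ta]]] y|nuy].
  by rewrite nu2_sub_le_dvdn ?e_num_le // (transfer_phase_dvdn N0 y ta).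
exists (pi / 2 ^+ (logn 2 (l + (z \in S))).+1); apply/pst_phase.
split; first by rewrite divr_gt0 ?pi_gt0 ?exprn_gt0.
by apply: transfer_phase_exists => // y; rewrite -nu2_sub_le_dvdn ?e_num_le.
Qed.

Lemma pst_time (t : R) : (0 < l)%N ->
  pst_at (cayley S) t -> odd_multiple (pi / 2 ^+ (logn 2 (l + (z \in S))).+1) t.
Proof.
move=> l0 /pst_phase[_ [a ta]].
have N0 : (0 < l + (z \in S))%N by rewrite addn_gt0 l0.
(* Any class would do; [l0] supplies the one of index 0. The factor 2 in the weights matches the
   doubled deficit. *)
apply: (transfer_phase_odd_multiple (M := k)
  (w := fun y => sgnchar y (vec (x (Ordinal l0))) *+ 2) N0 _ ta).
rewrite -(sum_sgnchar_deficit (Ordinal l0)).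
by apply: eq_bigr => y _; rewrite mulrnAl.
Qed.

End StateTransfer.

(** * Both cases of the theorem *)

Theorem theorem4p7 (R : realType) (gT : finGroupType) (n : nat) (z : gT)
    (phi : {morphism ([set: gT] / 'Z([set: gT]))%g >-> 'rV['F_2]_(2 * n)})
    (S : {set gT}) (l : nat) (x : 'I_l -> gT)
    (hn : (0 < n)%N)
    (hG : extraspecial_2group [set: gT])
    (hcard : #|gT| = (2 ^ (2 * n + 1))%N)
    (hz : 'Z([set: gT])%g = [set 1%g; z])
    (hphi : isom ([set: gT] / 'Z([set: gT]))%g [set: 'rV['F_2]_(2 * n)] phi)
    (hS : admissible S)
    (hx : class_decomposition S z x) :
  let e := e_num (fun i => phi (coset 'Z([set: gT])%g (x i))) in
  let cond_i := z \in S /\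
    forall y : 'rV['F_2]_(2 * n),
      (nu2 (l.+1)%:Z <= nu2 (l%:Z - (e y)%:Z))%E in
  let cond_ii := z \notin S /\
    forall y : 'rV['F_2]_(2 * n),
      (nu2 l%:Z <= nu2 (l%:Z - (e y)%:Z))%E in
  ((exists tau : R, pst_at (cayley S) tau) <-> cond_i \/ cond_ii) /\
  (forall tau : R, pst_at (cayley S) tau ->
    (cond_i -> odd_multiple (pi / 2 ^+ logn 2 (2 * l + 2)) tau) /\
    (cond_ii -> odd_multiple (pi / 2 ^+ logn 2 (2 * l)) tau)).
Proof.
move=> e cond_i cond_ii; have [_ cardZ _] := hG.
have l0 : (0 < l)%N.
  apply: (class_count_gt0 cardZ hz hx) => //.
  rewrite hcard addn1 expnS -[X in (X < _)%N]muln1 ltn_pmul2l //.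
  by rewrite -(expn0 2) ltn_exp2l // muln_gt0.
(* The extra 1 in the exponent of the time is absorbed as nu_2(2m). *)
have log2 m : (0 < m)%N -> (logn 2 m).+1 = logn 2 (2 * m).
  by move=> m0; rewrite lognM.
have pst := pst_iff R cardZ hz hphi hx l0.
have time := pst_time (R := R) cardZ hz hphi hx l0.
rewrite pst; split; last first.
  move=> t /time tt; split=> -[zS _].
    by move: tt; rewrite zS addn1 log2 // mulnS addnC.
  by move: tt; rewrite (negPf zS) addn0 log2.
rewrite /cond_i /cond_ii; case: (z \in S); rewrite /= ?addn0 ?addn1; intuition.
Qed.
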